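(* Consider the centered hexagonal tiling (CHT) with central tile at the origin, and let $x$ be the center of a tile that does not lie along any of the twelve rays emanating from the origin at multiples of $30^\circ$ from the horizontal. Then $x$ can be written as $x = i\,\vec e_n + j\,\vec e_{1+\mathrm{mod}_3(n+1)}$ with $n\in\{1,2,3\}$ and integers $i,j$ satisfying $Q(|i|)=Q(|j|)$, and for such $n,i,j$ one has $i\pm j\neq 0$ and the parity of the tile at $x$ is $$\mathrm{mod}_2\left(\left\lfloor \frac{i}{Q(|i-j|)}\right\rfloor+\left\lfloor \frac{i}{Q(|i+j|)}\right\rfloor\right).$$
   Context: The prototile. Take a regular hexagon with vertices $v_0,\dots,v_5$ in counterclockwise order, indices mod 6. On each edge fix two points, symmetric about the edge's midpoint; a marking meeting the edge at one of them is said to meet it near the endpoint to which that point is closer. The prototile decoration consists of the following. Black stripes: a short curved stripe around $v_0$ joining edges $v_5v_0$ and $v_0v_1$ and meeting both near $v_0$; a short curved stripe around $v_3$ joining edges $v_2v_3$ and $v_3v_4$ and meeting both near $v_3$; and a long straight stripe joining the opposite edges $v_1v_2$ and $v_4v_5$, perpendicular to them and displaced from the center to one side: it meets them either near $v_1$ and $v_5$ (displaced toward $v_0$) or near $v_2$ and $v_4$ (displaced toward $v_3$). Colored diameters: diameter $v_1v_4$ is entirely red; diameter $v_2v_5$ is entirely blue; diameter $v_0v_3$ is the ''red–blue diameter'', one of its halves (from the center to a vertex) being red and the other blue. By convention every reflection interchanges red and blue. The $12$ decorations of a hexagon obtained by choosing which diameter plays the role of $v_0v_3$ (then, going counterclockwise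 by $60^\circ$ from it, the next diameter is red and the following one is blue), the displacement of the long stripe, and which half of the red–blue diameter is red, are exactly the $12$ images of one single prototile under the rotations and reflections of the hexagon. Rule (R1): black stripes are continuous across every edge, i.e. the two tiles sharing an edge have their black stripes meeting that edge at the same point. Rule (R2): for every edge of the tiling with endpoints $p,q$, let $t_p$ (resp. $t_q$) be the tile that has $p$ (resp. $q$) as a vertex but does not contain the edge $pq$; the half-diameter of $t_p$ ending at $p$ and the half-diameter of $t_q$ ending at $q$ must have different colors. Coordinates: $\vec e_1,\vec e_2,\vec e_3$ are the unit vectors at angles $120^\circ,240^\circ,0^\circ$ from the horizontal; $\Lambda=\mathbb Z\vec e_1+\mathbb Z\vec e_2$ (so $\vec e_3=-\vec e_1-\vec e_2\in\Lambda$). The hexagonal tiles are the Voronoi cells of $\Lambda$ (their vertices are in directions $30^\circ+60^\circ k$ from their centers). CHT: a tiling with tile centers $\Lambda$ satisfying (R1) and (R2) such that for every $m\ge 1$ each tile centered at $x\in 2^{m-1}\Lambda\setminus 2^m\Lambda$ (a level $m$ tile) has its long black stripe parallel to the direction $u\in\{\vec e_1,\vec e_2,\vec e_3\}$ for which $x\pm 2^{m-1}u\in 2^m\Lambda$ (equivalently, its red–blue diameter is perpendicular to $u$). The central tile, at $0$, may have any of the $12$ decorations. Parity: a tile has black stripe parity $p_{\rm BS}=1$ if its long black stripe is displaced from the tile center in one of the directions $90^\circ,210^\circ,330^\circ$, and $p_{\rm BS}=0$ if in one of the directions $30^\circ,150^\circ,270^\circ$. It has red–blue parity $p_{\rm RB}=1$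 if the red half of its red–blue diameter points from the center in one of the directions $90^\circ,210^\circ,330^\circ$, and $p_{\rm RB}=0$ otherwise. Its parity is $\mathrm{mod}_2(p_{\rm BS}+p_{\rm RB})$; the two values of the parity distinguish the two mirror-image forms of the tile. Notation: $Q(k)=\mathrm{GCD}(2^k,k)$ for integers $k\ge1$ (the largest power of $2$ dividing $k$), with the convention $Q(0)=\infty$; $\mathrm{mod}_k(m)\in\{0,\dots,k-1\}$ is the residue of $m$ modulo $k$; $\lfloor y\rfloor$ is the greatest integer not exceeding $y$. *)

(* Defs.v *)
From mathcomp Require Import all_boot all_order all_algebra.

Set Implicit Arguments.
Unset Strict Implicit.
Unset Printing Implicit Defensive.

Import GRing.Theory.
Local Open Scope ring_scope.

(* Lambda: (a, b) stands for a e_1 + b e_2, where e_1 and e_2 are the unit vectors at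
   120 and 240 degrees. *)
Definition lattice : Type := (int * int)%type.

(* Only e 1, e 2 and e 3 are meaningful; e 3 = - e 1 - e 2 points at 0 degrees. *)
Definition e (n : nat) : lattice :=
  if n == 1%N then (1, 0) else if n == 2%N then (0, 1) else (-1, -1).

(* The linear rotation by 60 degrees: it maps e_1 to - e_3 and e_2 to - e_1. *)
Definition rot60 (x : lattice) : lattice := (x.1 - x.2, x.1).

(* The unit vector at 60 k degrees. *)
Definition dir (k : 'Z_6) : lattice := iter k rot60 (e 3).

(* Vertex k of the tile centered at x lies in direction 30 + 60 k degrees; it is
   the center x + (dir k + dir (k + 1)) / 3 of a triangle of lattice points.
   Points of Lambda / 3 are represented by their triples in Lambda. *)
Definition vertex (x : lattice) (k : 'Z_6) : lattice :=
  x *+ 3 + dir k + dir (k + 1).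

(* A lattice point on the ray through a nonzero lattice vector v is a
   nonnegative rational multiple of v.  Each ray contains the origin. *)
Definition on_ray (v x : lattice) : Prop :=
  exists p q : nat, (0 < q)%N /\ x *+ q = v *+ p.

(* dir k + dir (k + 1) points at 30 + 60 k degrees. *)
Definition on_twelve_rays (x : lattice) : Prop :=
  exists k : 'Z_6, on_ray (dir k) x \/ on_ray (dir k + dir (k + 1)) x.

(* The vertices of the prototile are v_0, ..., v_5 in counterclockwise order.
   Diameter v_0 v_3 is half red and half blue, v_1 v_4 is red, v_2 v_5 is blue.
   Short black stripes cut off the corners v_0 and v_3; the long one joins the
   edges v_1 v_2 and v_4 v_5, displaced toward v_0 or v_3.
   A decoration records which vertex v_0 among the vertices at 30, 90 and 150 degrees
   ends the red-blue diameter, whether the long stripe is displaced toward v_0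
   (rather than v_3), and whether the red half of the red-blue diameter ends at
   v_0 (rather than v_3).  Letting v_0 range over only three vertices selects a
   diameter, so that each of the 12 decorations is listed once. *)
Record decoration := Decoration {
  axis : 'I_3;
  displaced_to_v0 : bool;
  red_to_v0 : bool
}.

(* Geometric index of the vertex v_r of the prototile. *)
Definition role_vertex (t : decoration) (r : 'Z_6) : 'Z_6 :=
  (axis t : nat)%:R + r.

Definition role (t : decoration) (k : 'Z_6) : 'Z_6 := k - (axis t : nat)%:R.

(* The vertex near which the black stripe meets the edge v_r v_(r+1). *)
Definition near_role (displaced : bool) (r : 'Z_6) : 'Z_6 :=
  match nat_of_ord r with
  | 0 | 5 => 0
  | 2 | 3 => 3
  | 1 => if displaced then 1 else 2
  | _ => if displaced then 5 else 4
  end.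

(* The same, for the edge joining the vertices k and k + 1. *)
Definition near (t : decoration) (k : 'Z_6) : 'Z_6 :=
  role_vertex t (near_role (displaced_to_v0 t) (role t k)).

(* Whether the half-diameter ending at vertex k is red (otherwise it is blue). *)
Definition is_red (t : decoration) (k : 'Z_6) : bool :=
  match nat_of_ord (role t k) with
  | 1 | 4 => true
  | 2 | 5 => false
  | 0 => red_to_v0 t
  | _ => ~~ red_to_v0 t
  end.

(* The long stripe is perpendicular to the edge v_1 v_2, whose midpoint lies in
   direction 90 degrees counterclockwise of v_0. *)
Definition long_stripe_parallel (t : decoration) (u : lattice) : Prop :=
  let w := dir (role_vertex t 2) in u = w \/ u = - w.

Definition tiling : Type := lattice -> decoration.

(* A point where stripes meet an edge is identified by the nearer endpoint.
   Tiles are traversed counterclockwise, so a common edge is run through in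
   opposite directions by its two tiles. *)
Definition R1 (T : tiling) : Prop :=
  forall (x y : lattice) (k l : 'Z_6),
    vertex x k = vertex y (l + 1) -> vertex x (k + 1) = vertex y l ->
    vertex x (near (T x) k) = vertex y (near (T y) l).

Definition has_edge (x p q : lattice) : Prop :=
  exists k : 'Z_6,
    (vertex x k = p /\ vertex x (k + 1) = q) \/
    (vertex x k = q /\ vertex x (k + 1) = p).

(* The tiles y and z are those meeting the edge p q in one of its endpoints. *)
Definition R2 (T : tiling) : Prop :=
  forall (x p q : lattice), has_edge x p q ->
  forall (y z : lattice) (a b : 'Z_6),
    vertex y a = p -> ~ has_edge y p q ->
    vertex z b = q -> ~ has_edge z p q ->
    is_red (T y) a != is_red (T z) b.

(* Membership in 2^m Lambda. *)
Definition in_scaled (m : nat) (x : lattice) : Prop :=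
  exists y : lattice, x = y *+ 2 ^ m.

Definition CHT (T : tiling) : Prop :=
  [/\ R1 T, R2 T &
    forall (m : nat) (x : lattice), (1 <= m)%N ->
      in_scaled m.-1 x -> ~ in_scaled m x ->
      forall n : nat, (1 <= n <= 3)%N ->
        in_scaled m (x + e n *+ 2 ^ m.-1) ->
        in_scaled m (x - e n *+ 2 ^ m.-1) ->
        long_stripe_parallel (T x) (e n)].

(* The vertices in directions 90, 210 and 330 degrees are those of odd index. *)
Definition p_BS (t : decoration) : nat :=
  odd (role_vertex t (if displaced_to_v0 t then 0 else 3)).

Definition p_RB (t : decoration) : nat :=
  odd (role_vertex t (if red_to_v0 t then 0 else 3)).

Definition parity (t : decoration) : nat := ((p_BS t + p_RB t) %% 2)%N.

(* The largest power of 2 dividing k, for k >= 1; Qpos 0 = 1 is meaningless. *)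
Definition Qpos (k : nat) : nat := gcdn (2 ^ k) k.

(* None stands for the value infinity at 0. *)
Definition Q (k : nat) : option nat :=
  if k == 0%N then None else Some (Qpos k).

Definition floor_div (i : int) (d : nat) : int :=
  Num.floor (i%:~R / d%:R : rat).

(* Main.v *)
Require Import Defs.
From mathcomp Require Import all_boot all_order all_algebra.
From mathcomp Require Import zify.
Import GRing.Theory.
Local Open Scope ring_scope.

(** Write lattice points as [pt n i j] = i e_n + j e_(n-1), with indices mod 3.
    The CHT condition reads off the direction of the long stripe from the 2-adic
    valuations of the two coordinates: the stripe is along e_n if i has the smaller
    valuation, along e_(n-1) if j has, and along e_(n+1) = - (e_n + e_(n-1)) if they
    are equal ([axis_odd_even], [axis_odd_odd]).  In the last case the red-blue
    diameter lies along e_n - e_(n-1), which is perpendicular to e_(n+1).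

    Fix a tile with equal valuations and consider the two lines through it.

    Along e_n + e_(n-1) the difference d = i - j is constant.  Let q be the largest
    power of 2 dividing d.  If q does not divide i, then i and j have the same
    valuation, so the long stripe runs along the line and crosses the tile without
    changing sides.  If q divides i, exactly one of i/q, j/q is odd, the long stripe
    is transversal, and the line meets a short stripe of the tile, whose side depends
    only on the parity of i/q.  By (R1) the side of the stripe at any i is thus the one
    imposed by the last multiple of q before it, and so it is the parity of
    floor(i/q) ([stripe_line]).

    Along e_n - e_(n-1) the sum s = i + j is constant, and (R2) plays the part of (R1):
    with q the largest power of 2 dividing s, a tile with q not dividing i has its
    red-blue diameter on the line, which keeps its orientation from one such tile to
    the next, while a tile with q dividing i shows there a diameter of a single color,
    which alternates with i/q ([diam_line]).

    Both mechanisms are the same statement about sequences indexed by the integers,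
    [floor_parity_along_line].  A tile with equal valuations has its displacement
    decided by the first line and its coloring by the second ([parityE]), which gives
    the two floors.  Such a coordinate system exists at every point off the rays,
    because exactly one of the three e_r is the direction of its stripe. *)

(** * Finite case analysis *)

Lemma indexP n : (1 <= n <= 3)%N -> [\/ n = 1, n = 2 | n = 3]%N.
Proof.
by case: n => [|[|[|[|n]]]] //= _; [constructor 1|constructor 2|constructor 3].
Qed.

Lemma I3P (a : 'I_3) : [\/ a = inord 0, a = inord 1 | a = inord 2].
Proof.
case: a => [] [|[|[|k]]] // lt_k; [constructor 1|constructor 2|constructor 3];
  by apply/val_inj; rewrite /= inordK.
Qed.

(** Case analysis with the six values written as numerals, so that closed goals about
    them are decided by computation. *)
Lemma Z6P (P : 'Z_6 -> Prop) :
  P 0 -> P 1 -> P 2 -> P 3 -> P 4 -> P 5 -> forall k, P k.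
Proof.
move=> P0 P1 P2 P3 P4 P5 [k lt_k].
case: k lt_k => [|[|[|[|[|[|k]]]]]] lt_k //.
- by rewrite (_ : Ordinal _ = 0) //; apply/val_inj.
- by rewrite (_ : Ordinal _ = 1) //; apply/val_inj.
- by rewrite (_ : Ordinal _ = 2) //; apply/val_inj.
- by rewrite (_ : Ordinal _ = 3) //; apply/val_inj.
- by rewrite (_ : Ordinal _ = 4) //; apply/val_inj.
- by rewrite (_ : Ordinal _ = 5) //; apply/val_inj.
Qed.

(** * Powers of two *)

Lemma odd_part (a : int) : a != 0 ->
  exists (m : nat) (b : int), a = (2 ^ m)%N%:Z * b /\ ~~ (2 %| b)%Z.
Proof.
move=> a_neq0; have a_gt0 : (0 < `|a|)%N by lia.
have [k ck ka] := pfactor_coprime (isT : prime 2) a_gt0.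
move: ka; set m := logn _ _ => ka; rewrite coprime2n in ck.
exists m; case: (boolP (a < 0)) => ?; [exists (- k%:Z)|exists k%:Z]; split; lia.
Qed.

Lemma Qpos_odd_part m (b : int) : ~~ (2 %| b)%Z ->
  Qpos `|((2 ^ m)%N%:Z * b)%R|%N = (2 ^ m)%N.
Proof.
move=> b_odd; rewrite /Qpos abszM absz_nat.
have b_gt0 : (0 < `|b|)%N by lia.
have le_m : (m <= 2 ^ m * `|b|)%N.
  by apply: leq_trans (ltnW (ltn_expl m (ltnSn 1))) _; rewrite leq_pmulr.
rewrite -{1}(subnKC le_m) expnD -muln_gcdr.
suff /eqP-> : coprime (2 ^ (2 ^ m * `|b| - m)) `|b| by rewrite muln1.
by apply: coprimeXl; rewrite coprime2n; lia.
Qed.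

Lemma Q_odd_part m (b : int) : ~~ (2 %| b)%Z ->
  Q `|((2 ^ m)%N%:Z * b)%R|%N = Some (2 ^ m)%N.
Proof.
move=> b_odd; rewrite /Q Qpos_odd_part // ifN // abszM muln_eq0 expn_eq0 /= absz_eq0.
by apply: contraNneq b_odd => ->; rewrite dvdz0.
Qed.

Lemma equal_Q_odd_parts (i j : int) : i != 0 -> Q `|i|%N = Q `|j|%N ->
  exists m a b, [/\ i = (2 ^ m)%N%:Z * a, j = (2 ^ m)%N%:Z * b,
    ~~ (2 %| a)%Z & ~~ (2 %| b)%Z].
Proof.
move=> /odd_part[m [a [-> a_odd]]]; rewrite Q_odd_part //.
have [->|/odd_part[m' [b [-> b_odd]]]] := eqVneq j 0; first by [].
by rewrite Q_odd_part // => -[/eqP]; rewrite eqn_exp2l // => /eqP <-; exists m, a, b.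
Qed.

Lemma floor_divE i q : (0 < q)%N -> floor_div i q = (i %/ q%:Z)%Z.
Proof.
move=> q_gt0; apply: Num.Theory.floor_def.
have q_gt0' : 0 < q%:R :> rat by rewrite Num.Theory.ltr0n.
rewrite Num.Theory.ler_pdivlMr // Num.Theory.ltr_pdivrMr // -[q%:R]/(q%:~R).
rewrite -!intrM ler_int ltr_int; lia.
Qed.

(** The integers a index the tiles of a line; [g a] and [f a] describe the markings of
    tile a on its backward and forward sides.  Tiles at multiples of q are sources,
    and every other tile passes on what it receives, so [f a] is the value emitted by
    the last source, at q * floor(a/q). *)
Lemma floor_parity_along_line (f g : int -> bool) (c : bool) (q : nat) :
  (0 < q)%N ->
  (forall a, g (a + 1) = f a) ->
  (forall a, ~~ (q %| a)%Z -> f a = g a) ->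
  (forall a, f (q%:Z * a) = ~~ (2 %| a)%Z (+) c) ->
  forall a, f a = ~~ (2 %| (a %/ q)%Z)%Z (+) c.
Proof.
move=> q_gt0 step pass source a.
have [r lt_r {1}->] : exists2 r : nat, (r < q)%N & a = q%:Z * (a %/ q)%Z + r%:Z.
  by exists `|(a %% q)%Z|%N; lia.
elim: r lt_r => [|r IHr] lt_r; first by rewrite addr0 source.
rewrite pass; last first.
  apply/negP=> /dvdz_mod0P; rewrite mulrC modzMDl.
  by rewrite modz_small; lia.
rewrite -[r.+1]addn1 PoszD addrA step IHr //; lia.
Qed.

(** * Coordinates with respect to two consecutive unit vectors *)

Definition next (n : nat) : nat := (1 + n %% 3)%N.
Definition prev (n : nat) : nat := (1 + (n + 1) %% 3)%N.
Definition pt (n : nat) (i j : int) : lattice := e n *~ i + e (prev n) *~ j.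

Lemma next13 n : (1 <= next n <= 3)%N.
Proof. by rewrite /next; lia. Qed.

Lemma prev13 n : (1 <= prev n <= 3)%N.
Proof. by rewrite /prev; lia. Qed.

(** The edge, numbered by its first vertex, that a tile shares with its neighbor in
    direction e_n + e_(n-1) = - e_(n+1).  A long stripe along e_(n+1) crosses it. *)
Definition stripe_edge (n : nat) : 'Z_6 := n%:R + n%:R - 2.

(** The vertex of a tile in direction e_n - e_(n-1), which is perpendicular
    to e_(n+1). *)
Definition diam_end (n : nat) : 'Z_6 := n%:R + n%:R.

(** Three times the vector from the center of a tile to its vertex k. *)
Definition spoke (k : 'Z_6) : lattice := dir k + dir (k + 1).

Lemma pair_mulrz (a b i : int) : (a, b) *~ i = (a * i, b * i) :> lattice.
Proof.
by rewrite -!mulrzz; case: i => m; rewrite ?NegzE ?mulrNz -!pmulrn pairMnE.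
Qed.

Lemma pt_coords n i j : (1 <= n <= 3)%N ->
  pt n i j = if n == 1%N then (i - j, - j) else
             if n == 2%N then (j, i) else (- i, j - i).
Proof.
by move/indexP=> [] ->; rewrite /pt /prev /e /= !pair_mulrz; congr pair => /=; lia.
Qed.

Lemma pt_addM n i j k l (q : nat) : (1 <= n <= 3)%N ->
  pt n i j + pt n k l *+ q = pt n (i + q%:Z * k) (j + q%:Z * l).
Proof.
move=> n13; rewrite !pt_coords //.
by case/indexP: n13 => -> /=; rewrite pairMnE /= !pmulrn !mulrzz;
  congr pair => /=; lia.
Qed.

Lemma pt_stripe_step n i j : (1 <= n <= 3)%N ->
  pt n (i + 1) (j + 1) = pt n i j + dir (stripe_edge n + 1).
Proof.
move=> n13; rewrite !pt_coords //.
case/indexP: n13 => ->; rewrite /dir /rot60 /e /=; congr pair => /=; lia.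
Qed.

Lemma pt_diam_step n i j : (1 <= n <= 3)%N ->
  pt n (i + 1) (j - 1) = pt n i j + spoke (diam_end n).
Proof.
move=> n13; rewrite !pt_coords //.
case/indexP: n13 => ->; rewrite /spoke /dir /rot60 /e /=; congr pair => /=; lia.
Qed.

(** e_n and e_(n-1) form a basis of the lattice, so divisibility of a point can be
    tested on its coordinates. *)
Lemma in_scaled_pt m n i j : (1 <= n <= 3)%N ->
  in_scaled m (pt n i j) <-> ((2 ^ m)%N %| i)%Z /\ ((2 ^ m)%N %| j)%Z.
Proof.
move=> n13; rewrite pt_coords //; set q := (2 ^ m)%N; split.
  case=> -[a b]; rewrite pairMnE /= !pmulrn !mulrzz -/q.
  by case/indexP: n13 => -> [? ?]; split; apply/dvdzP;
    [exists (a - b)|exists (- b)|exists b|exists a|exists (-a)|exists (b - a)]; lia.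
case=> /dvdzP[a ->] /dvdzP[b ->].
case/indexP: n13 => ->; [exists (a - b, - b)|exists (b, a)|exists (- a, b - a)];
  rewrite pairMnE /= !pmulrn !mulrzz -/q; congr pair; lia.
Qed.

(** * The twelve rays *)

Lemma on_ray_mulrz v (i : int) : on_ray v (v *~ i) \/ on_ray (- v) (v *~ i).
Proof.
case: i => m; [left; exists m, 1%N|right; exists m.+1, 1%N]; split; rewrite // mulr1n.
by rewrite NegzE mulrNz mulNrn pmulrn.
Qed.

Lemma dirN k : - dir k = dir (k + 3).
Proof. by elim/Z6P: k. Qed.

Lemma spokeN k : - spoke k = spoke (k + 3).
Proof. by elim/Z6P: k. Qed.

Lemma dir_on_rays k i : on_twelve_rays (dir k *~ i).
Proof.
by case: (on_ray_mulrz (dir k) i); [exists k|rewrite dirN; exists (k + 3)]; left.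
Qed.

Lemma spoke_on_rays k i : on_twelve_rays (spoke k *~ i).
Proof.
by case: (on_ray_mulrz (spoke k) i); [exists k|rewrite spokeN; exists (k + 3)]; right.
Qed.

Lemma pt_diag_on_rays n i : (1 <= n <= 3)%N -> on_twelve_rays (pt n i i).
Proof.
move=> n13; rewrite /pt -mulrzDl.
have -> : e n + e (prev n) = dir (stripe_edge n + 1) by case/indexP: n13 => ->.
exact: dir_on_rays.
Qed.

Lemma pt_antidiag_on_rays n i : (1 <= n <= 3)%N -> on_twelve_rays (pt n i (- i)).
Proof.
move=> n13; rewrite /pt mulrNz -mulrzBl.
have -> : e n - e (prev n) = spoke (diam_end n) by case/indexP: n13 => ->.
exact: spoke_on_rays.
Qed.

(** The coordinates of x = A e_1 + B e_2 in the three systems are (B, A), (- A, B - A)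
    and (A - B, - B).  The first pair has equal valuations if A and B do; otherwise
    the term of smaller valuation dominates the difference A - B, and the pair built
    from it and the difference has equal valuations. *)
Lemma equal_Q_coordinates_exist x : ~ on_twelve_rays x ->
  exists (n : nat) (i j : int),
    [/\ (1 <= n <= 3)%N, x = pt n i j & Q `|i|%N = Q `|j|%N].
Proof.
case: x => A B off.
have /odd_part[m [a [AE a_odd]]] : A != 0.
  apply/eqP => A0; apply: off; rewrite A0.
  suff -> : (0, B) = dir 4 *~ B by apply: dir_on_rays.
  by rewrite /dir /rot60 /e /= pair_mulrz; congr pair; lia.
have /odd_part[m' [b [BE b_odd]]] : B != 0.
  apply/eqP => B0; apply: off; rewrite B0.
  suff -> : (A, 0) = dir 2 *~ A by apply: dir_on_rays.
  by rewrite /dir /rot60 /e /= pair_mulrz; congr pair; lia.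
have [lt_mm|lt_mm|eq_mm] := ltngtP m m'.
- exists 3%N, (- A), (B - A); split; rewrite // ?pt_coords //=.
    by congr pair; lia.
  have -> : B - A = (2 ^ m)%N%:Z * (2 * ((2 ^ (m' - m.+1))%N%:Z * b) - a).
    rewrite AE BE mulrBr !mulrA -!PoszM -mulnA -expnS -expnD.
    by congr (Posz (2 ^ _) * _ - _); lia.
  by rewrite abszN AE !Q_odd_part //; lia.
- exists 1%N, (A - B), (- B); split; rewrite // ?pt_coords //=.
    by congr pair; lia.
  have -> : A - B = (2 ^ m')%N%:Z * (2 * ((2 ^ (m - m'.+1))%N%:Z * a) - b).
    rewrite AE BE mulrBr !mulrA -!PoszM -mulnA -expnS -expnD.
    by congr (Posz (2 ^ _) * _ - _); lia.
  by rewrite abszN BE !Q_odd_part //; lia.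
exists 2%N, B, A; split; rewrite ?pt_coords //.
by rewrite AE BE -eq_mm !Q_odd_part.
Qed.

(** * Crossing from a tile to the next one on a line *)

(** Relative to a traveller leaving the tile through the edge k, vertex k is on the
    right: this says on which side the stripe crosses the edge. *)
Definition at_start (t : decoration) (k : 'Z_6) : bool := near t k == k.

Lemma near_edge t k : near t k = k \/ near t k = k + 1.
Proof.
case: t => a s r; rewrite /near /role /role_vertex /=.
by case: (I3P a) => ->; rewrite inordK //=; elim/Z6P: k; case: s;
  first [by left; apply/val_inj | by right; apply/val_inj].
Qed.

Lemma vertexE x k : vertex x k = x *+ 3 + spoke k.
Proof. by rewrite /vertex /spoke addrA. Qed.

Lemma vertexD x v k : vertex (x + v) k = x *+ 3 + (v *+ 3 + spoke k).
Proof. by rewrite vertexE mulrnDl -addrA. Qed.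

Lemma vertex_plus x k v : vertex x k + v = x *+ 3 + (spoke k + v).
Proof. by rewrite vertexE -addrA. Qed.

Lemma spoke_inj : injective spoke.
Proof.
move=> k l /eqP kl; apply/eqP; apply: contraTT kl.
by elim/Z6P: k; elim/Z6P: l.
Qed.

Lemma vertex_inj x : injective (vertex x).
Proof. by move=> k l; rewrite !vertexE => /addrI/spoke_inj. Qed.

Lemma shared_edge_start x k :
  vertex x k = vertex (x + dir (k + 1)) (k + 3 + 1).
Proof. by rewrite vertexD vertexE; congr (_ + _); elim/Z6P: k. Qed.

Lemma shared_edge_end x k :
  vertex x (k + 1) = vertex (x + dir (k + 1)) (k + 3).
Proof. by rewrite vertexD vertexE; congr (_ + _); elim/Z6P: k. Qed.

(** The negation comes from the opposite orientations that the two tiles give to their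
    common edge. *)
Lemma R1_across T x k : R1 T ->
  at_start (T (x + dir (k + 1))) (k + 3) = ~~ at_start (T x) k.
Proof.
move=> r1; have := r1 _ _ _ _ (shared_edge_start x k) (shared_edge_end x k).
rewrite /at_start; set y := x + _ => E.
have k1 (c : 'Z_6) : (c + 1 == c) = false by elim/Z6P: c.
case: (near_edge (T x) k) E => ->.
  by rewrite (shared_edge_start x k) => /vertex_inj <-; rewrite k1 eqxx.
by rewrite (shared_edge_end x k) => /vertex_inj <-; rewrite k1 eqxx.
Qed.

(** The edge leaving a tile radially at its vertex k has the length of the radius, so
    it ends at the opposite vertex of the tile whose center is displaced by three
    radii. *)
Lemma vertex_beyond x k :
  vertex x k + spoke k = vertex (x + spoke k) (k + 3).
Proof. by rewrite vertexD vertex_plus; congr (_ + _); elim/Z6P: k. Qed.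

Lemma R2_across T x k : R2 T ->
  is_red (T (x + spoke k)) (k + 3) = ~~ is_red (T x) k.
Proof.
move=> r2.
have edge : has_edge (x + dir k) (vertex x k) (vertex x k + spoke k).
  exists (k + 1); right; rewrite !vertexD vertex_plus vertexE.
  by split; congr (_ + _); elim/Z6P: k.
have := r2 _ _ _ edge x (x + spoke k) k (k + 3) erefl.
rewrite -vertex_beyond => /(_ _ erefl) H.
suff : is_red (T x) k != is_red (T (x + spoke k)) (k + 3).
  by case: (is_red _ k); case: (is_red _ _).
have far_q (l : 'Z_6) : vertex x l <> vertex x k + spoke k.
  rewrite vertexE vertex_plus => /addrI/eqP.
  by apply/negP; elim/Z6P: k {edge H}; elim/Z6P: l.
have far_p (l : 'Z_6) : vertex (x + spoke k) l <> vertex x k.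
  rewrite vertexD vertexE => /addrI/eqP.
  by apply/negP; elim/Z6P: k {edge H far_q}; elim/Z6P: l.
by apply: H => -[l [] []];
  [move=> _ /far_q|move=> /far_q|move=> /far_p|move=> _ /far_p].
Qed.

(** * What a single tile does to the markings on a line *)

(** The value of [axis] for a tile with long stripe along e_n: stripes along
    e_1, e_3, e_2 are perpendicular to the directions 30, 90, 150 degrees. *)
Definition axis_of (n : nat) : 'I_3 :=
  if n == 1%N then inord 0 else if n == 2%N then inord 2 else inord 1.

Lemma axis_of_stripe t n : (1 <= n <= 3)%N ->
  long_stripe_parallel t (e n) -> axis t = axis_of n.
Proof.
case: t => a s r /indexP[] ->; rewrite /long_stripe_parallel /role_vertex /=;
by case: (I3P a) => ->; rewrite ?inordK //= /dir /rot60 /e /=; case.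
Qed.

(** A straight stripe stays on one side of the line, but it leaves the tile near the
    first vertex of one of the edges and near the second vertex of the other. *)
Lemma through_stripe t n : (1 <= n <= 3)%N -> axis t = axis_of (next n) ->
  at_start t (stripe_edge n) = ~~ at_start t (stripe_edge n + 3).
Proof.
case: t => a s r /indexP[] -> /= ->;
rewrite /at_start /near /role /role_vertex /axis_of /= inordK //=;
by case: s.
Qed.

Lemma through_diam t n : (1 <= n <= 3)%N -> axis t = axis_of (next n) ->
  is_red t (diam_end n) = ~~ is_red t (diam_end n + 3).
Proof.
case: t => a s r /indexP[] -> /= ->; rewrite /is_red /role /axis_of /= inordK //=;
by case: r.
Qed.

(** If the long stripe is transversal to the line, the edge on the line is met by a
    short stripe, whose position is independent of the displacement. *)
Lemma source_stripe t n b : (1 <= n <= 3)%N ->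
  axis t = axis_of (if b then prev n else n) ->
  at_start t (stripe_edge n) = ~~ b.
Proof.
case: t => a s r /indexP[] ->; case: b => /= ->;
rewrite /at_start /near /role /role_vertex /axis_of /= inordK //=;
by case: s.
Qed.

Lemma source_diam t n b : (1 <= n <= 3)%N ->
  axis t = axis_of (if b then prev n else n) ->
  is_red t (diam_end n) = b.
Proof.
by case: t => a s r /indexP[] ->; case: b => /= ->;
  rewrite /is_red /role /axis_of /= inordK.
Qed.

Lemma parityE t n : (1 <= n <= 3)%N -> axis t = axis_of (next n) ->
  parity t = ((at_start t (stripe_edge n) + ~~ is_red t (diam_end n)) %% 2)%N.
Proof.
case: t => a s r /indexP[] -> /= ->;
rewrite /parity /p_BS /p_RB /is_red /at_start /near /role /role_vertex /axis_of
  /= inordK //=;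
by case: s; case: r.
Qed.

(** * Stripe directions in the centered hexagonal tiling *)

(** The direction of the long stripe depends on the coordinates only through their
    common power of 2 and the parities of the cofactors. *)
Lemma axis_mod2 T n m a b r k l :
  CHT T -> (1 <= n <= 3)%N -> (1 <= r <= 3)%N -> e r = pt n k l ->
  (2 %| a - k)%Z -> (2 %| b - l)%Z -> ~ ((2 %| a)%Z /\ (2 %| b)%Z) ->
  axis (T (pt n ((2 ^ m)%N%:Z * a) ((2 ^ m)%N%:Z * b))) = axis_of r.
Proof.
move=> [_ _ cht] n13 r13 er ak bl ab; set q := (2 ^ m)%N.
have q_gt0 : (0 < q)%N by rewrite expn_gt0.
have scaledS c : ((2 ^ m.+1)%N %| q%:Z * c)%Z = (2 %| c)%Z.
  by rewrite expnSr PoszM dvdz_mul2l; lia.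
(* The level of this tile is m + 1, since levels start from 1. *)
apply: axis_of_stripe => //; apply: (cht m.+1) => //=.
- by apply/in_scaled_pt => //; rewrite !dvdz_mulr ?dvdzz.
- by move/(in_scaled_pt _ _ _ _ n13); rewrite !scaledS.
- rewrite er pt_addM //; apply/in_scaled_pt => //; rewrite -!mulrDr !scaledS; lia.
- have -> : pt n (q%:Z * a) (q%:Z * b) - e r *+ q
            = pt n (q%:Z * (a - k)) (q%:Z * (b - l)).
    by apply: (addIr (e r *+ q)); rewrite subrK er pt_addM // -!mulrDr !subrK.
  by apply/in_scaled_pt => //; rewrite !scaledS.
Qed.

Lemma axis_odd_odd T n m a b : CHT T -> (1 <= n <= 3)%N ->
  ~~ (2 %| a)%Z -> ~~ (2 %| b)%Z ->
  axis (T (pt n ((2 ^ m)%N%:Z * a) ((2 ^ m)%N%:Z * b))) = axis_of (next n).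
Proof.
move=> cht n13 a_odd b_odd; apply: (@axis_mod2 _ _ _ _ _ _ (-1) (-1)) => //.
- exact: next13.
- by rewrite pt_coords //; case/indexP: n13 => ->.
- lia.
- lia.
- lia.
Qed.

Lemma axis_odd_even T n m a b : CHT T -> (1 <= n <= 3)%N ->
  ~~ (2 %| a + b)%Z ->
  axis (T (pt n ((2 ^ m)%N%:Z * a) ((2 ^ m)%N%:Z * b))) =
  axis_of (if (2 %| a)%Z then prev n else n).
Proof.
move=> cht n13 ab_odd; case: ifP => a_even.
  apply: (@axis_mod2 _ _ _ _ _ _ 0 1) => //; try lia; first exact: prev13.
  by rewrite /pt mulr0z add0r.
apply: (@axis_mod2 _ _ _ _ _ _ 1 0) => //; try lia.
by rewrite /pt mulr0z addr0.
Qed.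

(** When a and b agree up to sign modulo a power of 2 that does not divide them, they
    have the same valuation. *)
Lemma axis_between T n v a b c : CHT T -> (1 <= n <= 3)%N ->
  ~~ ((2 ^ v)%N %| a)%Z ->
  b = (2 ^ v)%N%:Z * c + a \/ b = (2 ^ v)%N%:Z * c - a ->
  axis (T (pt n a b)) = axis_of (next n).
Proof.
move=> cht n13 va bE.
have a_neq0 : a != 0 by apply: contraNneq va => ->; rewrite dvdz0.
have [m [a' [aE a'_odd]]] := odd_part a a_neq0.
have lt_mv : (m < v)%N.
  rewrite ltnNge; apply: contra va => le_vm.
  by rewrite aE dvdz_mulr // dvdzE /= dvdn_exp2l.
have vE : (2 ^ v)%N%:Z = (2 ^ m)%N%:Z * (2 * (2 ^ (v - m.+1))%N%:Z).
  by rewrite -!PoszM -expnS -expnD; congr (Posz (2 ^ _)); lia.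
have [b' -> b'_odd] : exists2 b', b = (2 ^ m)%N%:Z * b' & ~~ (2 %| b')%Z.
  case: bE => ->; rewrite vE aE -!mulrA -?mulrDr -?mulrBr;
    by eexists; first reflexivity; lia.
by rewrite aE; apply: axis_odd_odd.
Qed.

(** * The two lines through a tile *)

Lemma stripe_line T n d : CHT T -> (1 <= n <= 3)%N -> d != 0 -> forall i,
  at_start (T (pt n i (i - d))) (stripe_edge n) =
  ~~ (2 %| (i %/ Qpos `|d|%N)%Z)%Z.
Proof.
move=> cht n13 /odd_part[v [d' [-> d'_odd]]] i; rewrite Qpos_odd_part //.
set q := (2 ^ v)%N; have [r1 _ _] := cht; rewrite -[RHS]addbF; move: i.
(* The backward marking is negated to offset the negation in [R1_across]. *)
apply: (@floor_parity_along_line _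
  (fun a => ~~ at_start (T (pt n a (a - q%:Z * d'))) (stripe_edge n + 3))).
- by rewrite expn_gt0.
- by move=> a; rewrite addrAC pt_stripe_step // R1_across //; apply: negbK.
- move=> a qa; apply: through_stripe => //.
  by apply: (@axis_between _ _ v _ _ (- d')) => //; left; lia.
- move=> a; rewrite -mulrBr addbF; apply: source_stripe => //.
  by apply: axis_odd_even => //; lia.
Qed.

Lemma diam_line T n s : CHT T -> (1 <= n <= 3)%N -> s != 0 -> forall i,
  is_red (T (pt n i (s - i))) (diam_end n) =
  (2 %| (i %/ Qpos `|s|%N)%Z)%Z.
Proof.
move=> cht n13 /odd_part[v [s' [-> s'_odd]]] i; rewrite Qpos_odd_part //.
set q := (2 ^ v)%N; have [_ r2 _] := cht; rewrite -[RHS]negbK -addbT; move: i.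
apply: (@floor_parity_along_line _
  (fun a => ~~ is_red (T (pt n a (q%:Z * s' - a))) (diam_end n + 3))).
- by rewrite expn_gt0.
- by move=> a; rewrite opprD addrA pt_diam_step // R2_across //; apply: negbK.
- move=> a qa; apply: through_diam => //.
  by apply: (@axis_between _ _ v _ _ s') => //; right.
- move=> a; rewrite -mulrBr addbT negbK; apply: source_diam => //.
  by apply: axis_odd_even => //; lia.
Qed.

Theorem theorem5 (T : tiling) (x : lattice) :
  CHT T -> ~ on_twelve_rays x ->
  (exists (n : nat) (i j : int),
     [/\ (1 <= n <= 3)%N,
         x = e n *~ i + e (1 + (n + 1) %% 3)%N *~ j
       & Q `|i|%N = Q `|j|%N]) /\
  (forall (n : nat) (i j : int),
     (1 <= n <= 3)%N ->
     x = e n *~ i + e (1 + (n + 1) %% 3)%N *~ j ->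
     Q `|i|%N = Q `|j|%N ->
     [/\ i - j != 0, i + j != 0
       & (parity (T x))%:Z
         = ((floor_div i (Qpos `|(i - j)%R|%N)
             + floor_div i (Qpos `|(i + j)%R|%N)) %% 2)%Z]).
Proof.
move=> cht off; split; first exact: equal_Q_coordinates_exist.
move=> n i j n13; rewrite -/(prev n) -/(pt n i j) => xE Qij.
have d_neq0 : i - j != 0.
  by apply/eqP => /subr0_eq ij; apply: off; rewrite xE ij; apply: pt_diag_on_rays.
have s_neq0 : i + j != 0.
  by apply/eqP => /addr0_eq ij; apply: off; rewrite xE -ij; apply: pt_antidiag_on_rays.
split=> //.
have i_neq0 : i != 0.
  apply/eqP => i0; move: Qij; rewrite /Q i0 /=.
  by case: eqP => // j0 _; move: d_neq0; lia.
have ax : axis (T x) = axis_of (next n).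
  have [m [a [b [iE jE a_odd b_odd]]]] := equal_Q_odd_parts i j i_neq0 Qij.
  by rewrite xE iE jE; apply: axis_odd_odd.
have Qpos_gt0 k : k != 0 -> (0 < Qpos `|k|)%N by rewrite /Qpos gcdn_gt0 expn_gt0.
rewrite !floor_divE ?Qpos_gt0 // (parityE _ _ n13 ax) xE.
have -> : pt n i j = pt n i (i - (i - j)) by rewrite opprB addrC subrK.
rewrite stripe_line //.
have -> : pt n i (i - (i - j)) = pt n i (i + j - i) by congr pt; lia.
rewrite diam_line //.
by case: (boolP (2 %| _)%Z) => ?; case: (boolP (2 %| _)%Z) => ? /=; lia.
Qed.
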